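(* Let $\{\omega^k\}_{k=1}^n$ and $\{\tau^k\}_{k=1}^n$ be two admissible coframes of a MaxN pair $(\mathfrak{g},J)$. Write $\omega^k=\sum_{j=1}^n a^k_j\tau^j$ for $1\le k\le n$. Then $a^k_j=0$ for $j\ge k+1$ and $a^k_k\ne0$. Furthermore, for each $1\le k\le n$, $$d\omega^k+d\overline{\omega}^k=0\iff d\tau^k+d\overline{\tau}^k=0.$$
   Context: Lie algebras are real, of finite positive dimension. A complex structure on $\mathfrak{g}$ is a linear endomorphism $J:\mathfrak{g}\to\mathfrak{g}$ with $J^2=-1$ and $[JX,JY]=J[JX,Y]+J[X,JY]+[X,Y]$ for all $X,Y\in\mathfrak{g}$; $\dim_{\mathbb{C}}\mathfrak{g}=\frac12\dim_{\mathbb{R}}\mathfrak{g}=n$. $\mathfrak{g}^{1,0}$ is the $\sqrt{-1}$-eigenspace of $J$ acting on $\mathfrak{g}^*_{\mathbb{C}}=\mathfrak{g}^*\otimes_{\mathbb{R}}\mathbb{C}$ by $(J\alpha)(X)=\alpha(JX)$. $d$ is the Chevalley–Eilenberg differential, $d\alpha(X,Y)=-\alpha([X,Y])$, extended complex-linearly. Put $\mathfrak{a}_0=0$ and $\mathfrak{a}_k=\{X\in\mathfrak{g} : [X,\mathfrak{g}]\subseteq\mathfrak{a}_{k-1},\ [JX,\mathfrak{g}]\subseteq\mathfrak{a}_{k-1}\}$ for $k\ge1$. $J$ is nilpotent if $\mathfrak{a}_t=\mathfrak{g}$ for some $t$, and then $\nu(J)$ is the smallest such $t$. $(\mathfrak{g},J)$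 is MaxN if $\mathfrak{g}$ is nilpotent and $J$ is a nilpotent complex structure with $\nu(J)=\dim_{\mathbb{C}}\mathfrak{g}$. An admissible coframe of a MaxN pair is a basis $\{\omega^k\}_{k=1}^n$ of $\mathfrak{g}^{1,0}$ such that $$d\omega^k=\sum_{i<j<k}A_{ij}^k\,\omega^i\wedge\omega^j+\sum_{i,j<k}B_{ij}^k\,\omega^i\wedge\overline{\omega}^j,\qquad 1\le k\le n,$$ where for each $2\le k\le n$ the coefficients $\{A_{i,k-1}^k\}_{i<k-1}$, $\{B_{k-1,j}^k\}_{j=1}^{k-1}$, $\{B_{i,k-1}^k\}_{i<k-1}$ are not all zero, and each $\omega^k$ satisfies one of: (1) $d\omega^k+d\overline{\omega}^k=0$; (2) for $a,b\in\mathbb{C}$, $a\,d\omega^k+b\,d\overline{\omega}^k\in\mathrm{span}_{\mathbb{C}}\{d\omega^{j},d\overline{\omega}^{j} : 1\le j\le k-1\}$ if and only if $a=b=0$. *)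

(* Defs.v *)
From HB Require Import structures.
From mathcomp Require Import all_boot all_order all_algebra.
From mathcomp Require Import reals.
From mathcomp Require Import complex.

Set Implicit Arguments.
Unset Strict Implicit.
Unset Printing Implicit Defensive.

Import GRing.Theory.
Local Open Scope ring_scope.
Local Open Scope complex_scope.

Section LieAlgebra.
Context {R : realType} {g : vectType R}.
Variable br : {bilinear g -> g -> g}.

Record is_lie_bracket : Prop := IsLieBracket {
  lie_alternating : forall X, br X X = 0;
  lie_jacobi : forall X Y Z,
    br X (br Y Z) + br Y (br Z X) + br Z (br X Y) = 0
}.

(* By bilinearity, the brackets of basis vectors span [g, lcs k]. *)
Fixpoint lower_central (k : nat) : {vspace g} :=
  if k is k'.+1 then
    <<[seq br X Y | X <- vbasis {:g}, Y <- vbasis (lower_central k')]>>%VS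
  else fullv.

Definition nilpotent_lie : Prop := exists k, lower_central k = 0%VS.

Variable J : 'End(g).

Record complex_structure : Prop := ComplexStructure {
  complex_structure_sqr : forall X, J (J X) = - X;
  complex_structure_integrable : forall X Y,
    br (J X) (J Y) = J (br (J X) Y) + J (br X (J Y)) + br X Y
}.

Fixpoint asc (k : nat) (X : g) : Prop :=
  if k is k'.+1 then
    (forall Y, asc k' (br X Y)) /\ (forall Y, asc k' (br (J X) Y))
  else X = 0.

Definition nilpotent_J : Prop := exists t, forall X, asc t X.

Definition nu_is (t : nat) : Prop :=
  (forall X, asc t X) /\ forall s, (forall X, asc s X) -> (t <= s)%N.

End LieAlgebra.

(* The real dimension is even as soon as g carries J with J^2 = -1. *)
Definition cdim {R : realType} (g : vectType R) : nat := (\dim {:g})./2.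

Record MaxN (R : realType) (g : vectType R) (br : {bilinear g -> g -> g})
    (J : 'End(g)) : Prop := IsMaxN {
  MaxN_lie : is_lie_bracket br;
  MaxN_complex : complex_structure br J;
  MaxN_nilpotent_lie : nilpotent_lie br;
  MaxN_nilpotent_J : nilpotent_J br J;
  MaxN_nu : nu_is br J (cdim g)
}.

(* g^* (x)_R C is identified with the real-linear maps g -> C.  A complex
   2-form, complex-bilinear on g_C, is represented by its restriction to g,
   which determines it; linear combinations are written pointwise. *)
Notation cdual R g := {linear g -> R[i] | real_complex R \; *%R}.

Section Forms.
Context {R : realType} {g : vectType R}.
Variable br : {bilinear g -> g -> g}.
Variable J : 'End(g).

Definition conjform (a : g -> R[i]) : g -> R[i] := fun X => (a X)^*.

Definition dform (a : g -> R[i]) : g -> g -> R[i] := fun X Y => - a (br X Y).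

Definition wedge (a b : g -> R[i]) : g -> g -> R[i] :=
  fun X Y => a X * b Y - a Y * b X.

Definition form10 (a : cdual R g) : Prop := forall X, a (J X) = 'i%C * a X.

Record basis10 (n : nat) (w : 'I_n -> cdual R g) : Prop := Basis10 {
  basis10_mem : forall k, form10 (w k);
  basis10_free : forall c : 'I_n -> R[i],
    (forall X, \sum_(k < n) c k * w k X = 0) -> forall k, c k = 0;
  basis10_span : forall a : cdual R g, form10 a ->
    exists c : 'I_n -> R[i], forall X, a X = \sum_(k < n) c k * w k X
}.

(* The form w indexed by i : 'I_n is the (i+1)-st member of the coframe. *)
Section Coframe.
Variables (n : nat) (w : 'I_n -> cdual R g).

Definition structure_eqs (A B : 'I_n -> 'I_n -> 'I_n -> R[i]) : Prop :=
  forall k X Y,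
    dform (w k) X Y =
      \sum_(i < n) \sum_(j < n | (i < j < k)%N)
        A k i j * wedge (w i) (w j) X Y
    + \sum_(i < n | (i < k)%N) \sum_(j < n | (j < k)%N)
        B k i j * wedge (w i) (conjform (w j)) X Y.

Definition top_coeffs_nonzero (A B : 'I_n -> 'I_n -> 'I_n -> R[i]) : Prop :=
  forall k p : 'I_n, (p.+1 = k)%N ->
    [\/ exists i : 'I_n, (i < p)%N /\ A k i p != 0,
        exists j : 'I_n, (j <= p)%N /\ B k p j != 0
      | exists i : 'I_n, (i < p)%N /\ B k i p != 0].

Definition real_type (k : 'I_n) : Prop :=
  forall X Y, dform (w k) X Y + dform (conjform (w k)) X Y = 0.

Definition in_dspan_lt (k : 'I_n) (f : g -> g -> R[i]) : Prop :=
  exists c c' : 'I_n -> R[i], forall X Y,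
    f X Y = \sum_(j < n | (j < k)%N)
      (c j * dform (w j) X Y + c' j * dform (conjform (w j)) X Y).

Definition complex_type (k : 'I_n) : Prop :=
  forall a b : R[i],
    in_dspan_lt k
      (fun X Y => a * dform (w k) X Y + b * dform (conjform (w k)) X Y)
    <-> a = 0 /\ b = 0.

Record admissible_coframe : Prop := AdmissibleCoframe {
  admissible_basis : basis10 w;
  admissible_structure : exists A B : 'I_n -> 'I_n -> 'I_n -> R[i],
    structure_eqs A B /\ top_coeffs_nonzero A B;
  admissible_types : forall k, real_type k \/ complex_type k
}.

End Coframe.
End Forms.

(* Main.v *)
Require Import Defs.
From HB Require Import structures.
From mathcomp Require Import all_boot all_order all_algebra.
From mathcomp Require Import reals.
From mathcomp Require Import complex ring.

(** The ascending series a_s depends on the Lie bracket and J alone, and every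
    admissible coframe computes it: a_s is the common kernel of all members of
    the coframe but the last s (asc_kernel).  One inclusion holds because d w^k
    involves only the members before w^k (structure_eq_kernel).  For the other,
    let X and JX bracket g into a_(s-1), so that d w^k, for the relevant k,
    vanishes when either is inserted.  If the members before w^(k-1) already
    vanish at X, what remains of d w^k (X, -) is w^(k-1)(X) or its conjugate
    times the coefficients that involve the index k-1, and these are not all
    zero; hence w^(k-1)(X) = 0 (top_coeffs_vanish).

    Thus two admissible coframes w and t define the same flag of common
    kernels (common_kernel).  Evaluated at vectors dual to t, the equality of
    flags says that the transition matrix is triangular; evaluated at vectors
    dual to w, that its diagonal has no zero.

    For the last claim, expand 0 = d w^k + conj (d w^k) in t: it says that
    a_kk d t^k + conj(a_kk) conj(d t^k) is in the span of the earlier d t^j and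
    their conjugates.  Since a_kk != 0, this excludes the second alternative for
    t^k, so t^k is of the first kind (real_type_transition).  The converse is
    the same statement with the coframes exchanged. *)

Local Open Scope ring_scope.

(** * Forms of type (1,0) and dual vectors *)

Section Coframes.
Set Implicit Arguments.
Unset Strict Implicit.
Import GRing.Theory Num.Theory.
Local Open Scope complex_scope.
Local Notation "x ^*" := (conjc x) : ring_scope.
Variables (R : realType) (g : vectType R).
Variables (br : {bilinear g -> g -> g}) (J : 'End(g)).
Implicit Types (a : cdual R g) (X Y : g).

Lemma cdualZ a (c : R) X : a (c *: X) = c%:C * a X.
Proof. by rewrite linearZ. Qed.

Lemma i_neq0 : 'i%C != 0 :> R[i].
Proof. by rewrite eq_complex /= oner_eq0 andbF. Qed.

Lemma conj_iM (x : R[i]) : ('i%C * x)^* = - ('i%C * x^* ).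
Proof.
case: x => x y; apply/eqP; rewrite eq_complex /=.
by apply/andP; split; apply/eqP; ring.
Qed.

(** This separates the J-linear part u from the J-antilinear part v of an
    expression that vanishes both at a vector and at its image under J. *)
Lemma lin_antilin_eq0 {u v : R[i]} :
  u + v = 0 -> 'i%C * u - 'i%C * v = 0 -> u = 0 /\ v = 0.
Proof.
move=> uv; rewrite -mulrBr => /eqP; rewrite mulf_eq0 (negPf i_neq0) /=.
rewrite subr_eq0 => /eqP uEv; move: uv; rewrite uEv -mulr2n -mulr_natl => /eqP.
by rewrite mulf_eq0 pnatr_eq0 /= => /eqP ->.
Qed.

Section RealPart.
Variable l : {linear g -> R^o}.

(** Twice the (1,0)-part of the real functional l. *)
Definition form10_of_real (X : g) : R[i] := (l X)%:C - 'i%C * (l (J X))%:C.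

Fact form10_of_real_linear : GRing.linear_for (real_complex R \; *%R) form10_of_real.
Proof.
move=> c X Y; rewrite /form10_of_real /= !linearP /= !rmorphD !rmorphM /=.
by rewrite !mulrDr opprD mulrN addrACA (mulrCA 'i%C).
Qed.

HB.instance Definition _ :=
  GRing.isLinear.Build R g R[i] (real_complex R \; *%R)
    form10_of_real form10_of_real_linear.
End RealPart.

(** A real functional that is nonzero at X is the real part of a (1,0)-form. *)
Lemma ex_form10_neq0 X :
  (forall Z, J (J Z) = - Z) -> X != 0 ->
  exists2 a : cdual R g, form10 J a & a X != 0.
Proof.
move=> JJ X0.
have [i ci] : exists i, coord (vbasis {:g}) i X != 0.
  apply/existsP; apply: contraNT X0 => /existsPn ci0.
  rewrite (coord_vbasis (memvf X)) big1 // => i _.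
  by move: (ci0 i); rewrite negbK => /eqP ->; rewrite scale0r.
exists (form10_of_real (coord (vbasis {:g}) i) : cdual R g) => /=.
  move=> Y /=; rewrite /form10_of_real JJ linearN rmorphN mulrBr mulrA.
  by rewrite -[_ * 'i%C]/('i%C ^+ 2) sqr_i mulN1r opprK mulrN opprK addrC.
apply: contraNneq ci => /(congr1 (@complex.Re R)) /=.
by rewrite /form10_of_real /= !mul0r !mul1r subr0 oppr0 addr0 => ->.
Qed.

Section Basis.
Variables (n : nat) (w : 'I_n -> cdual R g).
Hypothesis w10 : basis10 J w.

Lemma basis10_eq0 X :
  (forall Z, J (J Z) = - Z) -> (forall k, w k X = 0) -> X = 0.
Proof.
move=> JJ wX0; apply/eqP; apply: contraTT isT => X0.
have [a a10] := ex_form10_neq0 JJ X0.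
have [c ->] := basis10_span w10 a10.
by rewrite big1 ?eqxx // => k _; rewrite wX0 mulr0.
Qed.

(** As complex functionals on (g, J) the w k are independent, hence X |-> (w k X)
    maps g onto C^n: the matrix M of their values on a real basis of g has
    independent columns, so some complex combination of its rows is any given
    vector, and the complex scalars are realised on g through J. *)
Lemma dual_vectors :
  exists e : 'I_n -> g, forall i j, w i (e j) = (i == j)%:R.
Proof.
pose M := \matrix_(b < \dim {:g}, k < n) w k (vbasis {:g})`_b.
have : row_full M.
  rewrite /row_full -mxrank_tr -/(row_free M^T) -kermx_eq0 -submx0.
  apply/row_subP => r; rewrite submx0; apply/eqP/rowP => k.
  have /sub_kermxP := row_sub r (kermx M^T).
  move: (row r _) => c cM; rewrite [RHS]mxE.
  apply: (basis10_free w10 (c := fun k => c 0 k)) => X.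
  rewrite (coord_vbasis (memvf X)).
  under eq_bigr => i _ do rewrite linear_sum mulr_sumr.
  rewrite exchange_big big1 //= => b _.
  under eq_bigr => i _ do rewrite cdualZ mulrCA.
  rewrite -mulr_sumr; have /rowP/(_ b) := cM; rewrite !mxE.
  under eq_bigr => i _ do rewrite !mxE.
  by move=> ->; rewrite mulr0.
case/row_fullP => u uM.
exists (fun j => \sum_b (complex.Re (u j b) *: (vbasis {:g})`_b
                     + complex.Im (u j b) *: J (vbasis {:g})`_b)) => i j.
have /matrixP/(_ j i) := uM; rewrite !mxE eq_sym => <-.
rewrite linear_sum; apply: eq_bigr => b _.
rewrite linearD !cdualZ (basis10_mem w10) mxE mulrA -mulrDl.
by rewrite [X in _ = X * _]complexE [(_ *i)%C * _]mulrC.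
Qed.
End Basis.

(** * The ascending series as a flag of common kernels *)

Section StructureEquations.
Variables (n : nat) (w : 'I_n -> cdual R g).
Variables A B : 'I_n -> 'I_n -> 'I_n -> R[i].
Hypothesis w10 : basis10 J w.
Hypothesis wAB : structure_eqs br w A B.

Lemma structure_eq_kernel {k : 'I_n} {X} Y :
  (forall i : 'I_n, (i < k)%N -> w i X = 0) -> w k (br X Y) = 0.
Proof.
move=> X0; apply/eqP; rewrite -oppr_eq0 -/(dform br (w k) X Y) wAB; apply/eqP.
rewrite !big1 ?addr0 // => i.
  move=> ik; rewrite big1 // => j jk.
  by rewrite /wedge /conjform !X0 // rmorph0 mul0r mulr0 subrr mulr0.
move=> _; rewrite big1 // => j /andP[ij jk].
by rewrite /wedge !X0 ?(ltn_trans ij jk) // mul0r mulr0 subrr mulr0.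
Qed.

(** When the members before w p vanish at X, only the terms of d (w k) with the
    index p in a slot evaluated at X survive. *)
Lemma structure_eq_top {k p : 'I_n} {X} Y :
  (p.+1 = k)%N -> (forall i : 'I_n, (i < p)%N -> w i X = 0) ->
  dform br (w k) X Y =
    w p X * (\sum_(j < n | (j < k)%N) B k p j * (w j Y)^*
             - \sum_(i < n | (i < p)%N) A k i p * w i Y)
    - (w p X)^* * \sum_(i < n | (i < k)%N) B k i p * w i Y.
Proof.
move=> pk X0; rewrite wAB.
have wX (i : 'I_n) : (i < k)%N -> w i X = if i == p then w p X else 0.
  rewrite -pk ltnS leq_eqVlt => /orP[/eqP/val_inj->|ip]; first by rewrite eqxx.
  by rewrite X0 // ifN // -val_eqE ltn_eqF.
have pltk : (p < k)%N by rewrite -pk.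
have -> : \sum_(i < n) \sum_(j < n | (i < j < k)%N)
    A k i j * wedge (w i) (w j) X Y
    = - (w p X * \sum_(i < n | (i < p)%N) A k i p * w i Y).
  rewrite mulr_sumr -sumrN [RHS]big_mkcond /=; apply: eq_bigr => i _.
  case: ifPn => ip.
    rewrite (bigD1 p) /= ?ip // big1 ?addr0 => [|j /andP[/andP[ij jk] jp]].
      by rewrite /wedge (X0 i ip) mul0r sub0r mulrN [w p X * _]mulrC mulrA.
    by rewrite /wedge (wX j) // (negPf jp) (X0 i ip) mulr0 mul0r subrr mulr0.
  rewrite big1 // => j /andP[ij jk]; exfalso; move: ip.
  by rewrite -leqNgt => pi; move: jk; rewrite -pk ltnS leqNgt (leq_ltn_trans pi).
have -> : \sum_(i < n | (i < k)%N) \sum_(j < n | (j < k)%N)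
    B k i j * wedge (w i) (conjform (w j)) X Y
    = w p X * \sum_(j < n | (j < k)%N) B k p j * (w j Y)^*
      - (w p X)^* * \sum_(i < n | (i < k)%N) B k i p * w i Y.
  under eq_bigr => i _.
    under eq_bigr => j _ do rewrite /wedge /conjform mulrBr.
    rewrite sumrB; over.
  rewrite sumrB; congr (_ - _).
    rewrite (bigD1 p) //= [X in _ + X]big1 ?addr0 => [|i /andP[ik ip]].
      by rewrite mulr_sumr; apply: eq_bigr => j _; rewrite mulrCA.
    by rewrite big1 // => j _; rewrite wX // (negPf ip) mul0r mulr0.
  rewrite exchange_big (bigD1 p) //= [X in _ + X]big1 ?addr0
    => [|j /andP[jk jp]].
    rewrite mulr_sumr; apply: eq_bigr => i _; ring.
  by rewrite big1 // => i _; rewrite (wX j) // (negPf jp) rmorph0 !mulr0.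
by rewrite mulrBr addrA [- _ + _]addrC.
Qed.

Hypothesis AB_top : top_coeffs_nonzero A B.

(** If w p X were nonzero, the values of d (w k) at X and J X would force the
    J-linear and J-antilinear parts of the surviving one-form to vanish;
    evaluating them at dual vectors kills every coefficient involving p. *)
Lemma top_coeffs_vanish {k p : 'I_n} {X} :
  (p.+1 = k)%N -> (forall i : 'I_n, (i < p)%N -> w i X = 0) ->
  (forall Y, w k (br X Y) = 0) -> (forall Y, w k (br (J X) Y) = 0) ->
  w p X = 0.
Proof.
move=> pk X0 brX brJX; apply/eqP; apply: contraT => x0.
have [e we] := dual_vectors w10.
have wJ := basis10_mem w10.
pose S Y := \sum_(j < n | (j < k)%N) B k p j * (w j Y)^*.
pose T Y := \sum_(i < n | (i < p)%N) A k i p * w i Y.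
pose Q Y := \sum_(i < n | (i < k)%N) B k i p * w i Y.
(* Multiplying X by J turns w p X into i times itself and its conjugate into
   -i times itself, which separates the two brackets. *)
have PQ0 Y : S Y - T Y = 0 /\ Q Y = 0.
  have [] := @lin_antilin_eq0 (w p X * (S Y - T Y)) (- ((w p X)^* * Q Y)).
  - have := structure_eq_top Y pk X0.
    by rewrite /dform brX oppr0 => <-.
  - have JX0 (i : 'I_n) : (i < p)%N -> w i (J X) = 0.
      by move=> ip; rewrite wJ X0 ?mulr0.
    have := structure_eq_top Y pk JX0.
    rewrite /dform brJX oppr0 wJ conj_iM -/(S Y) -/(T Y) -/(Q Y) => ->.
    by ring.
  move=> /eqP; rewrite mulf_eq0 (negPf x0) /= => /eqP -> /eqP.
  by rewrite oppr_eq0 mulf_eq0 conjc_eq0 (negPf x0) /= => /eqP ->.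
(* The same separation in the variable Y: T is J-linear and S antilinear. *)
have ST0 Y : - T Y = 0 /\ S Y = 0.
  apply: lin_antilin_eq0; first by rewrite addrC; case: (PQ0 Y).
  have [<- _] := PQ0 (J Y).
  have -> : S (J Y) = - ('i%C * S Y).
    rewrite mulr_sumr -sumrN; apply: eq_bigr => j _.
    by rewrite wJ conj_iM mulrN mulrCA.
  have -> : T (J Y) = 'i%C * T Y.
    by rewrite mulr_sumr; apply: eq_bigr => j _; rewrite wJ mulrCA.
  by rewrite mulrN addrC.
have delta (P : pred 'I_n) (F : 'I_n -> R[i]) i : P i ->
    \sum_(j < n | P j) F j * w j (e i) = F i.
  move=> Pi; rewrite (bigD1 i) //= we eqxx mulr1 big1 ?addr0 // => j /andP[_ ji].
  by rewrite we (negPf ji) mulr0.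
case: (AB_top pk) => -[i [ip]]; apply: contraNT => _; apply/eqP.
- have [/eqP + _] := ST0 (e i); rewrite oppr_eq0 => /eqP <-.
  by rewrite /T delta.
- have [_ <-] := ST0 (e i); rewrite /S -(delta (fun j : 'I_n => (j < k)%N)).
    apply: eq_bigr => j _; congr (_ * _); rewrite we.
    by rewrite rmorph_nat.
  by rewrite -pk ltnS.
- have [_ <-] := PQ0 (e i); rewrite /Q delta //.
  by rewrite -pk ltnS ltnW.
Qed.

Hypothesis JJ : forall Z, J (J Z) = - Z.

(** The flag on the right is built from the coframe, the series on the left is
    not: this is what makes the flag independent of the coframe. *)
Lemma asc_kernel s X :
  asc br J s X <-> forall i : 'I_n, (i + s < n)%N -> w i X = 0.
Proof.
elim: s X => [|s IHs] X /=.
  split=> [-> i _|wX0]; first exact: linear0.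
  by apply: (basis10_eq0 w10 JJ) => i; apply: wX0; rewrite addn0.
split=> [[ascX ascJX] i|wX0].
  (* d (w i.+1) detects w i only once the earlier members vanish at X, hence
     an inner induction on the index. *)
  have [m] := ubnP i; elim: m i => // m IHm i im isn.
  have i1n : (i.+1 < n)%N by rewrite (leq_trans _ isn) // -addSnnS ltnS leq_addr.
  apply: (@top_coeffs_vanish (Ordinal i1n) i) => // [j ji|Y|Y].
  - apply: IHm; first exact: leq_trans ji im.
    by rewrite (leq_trans _ isn) // ltnS leq_add2r ltnW.
  - by apply: (IHs _).1 => //=; rewrite addSnnS.
  - by apply: (IHs _).1 => //=; rewrite addSnnS.
have wbr Z : (forall i : 'I_n, (i + s.+1 < n)%N -> w i Z = 0) ->
    forall Y, asc br J s (br Z Y).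
  move=> wZ0 Y; apply/IHs => i isn; apply: structure_eq_kernel => j ji.
  by apply: wZ0; rewrite addnS (leq_ltn_trans _ isn) // -addSn leq_add2r.
split; apply: wbr => // i isn.
by rewrite (basis10_mem w10) wX0 ?mulr0.
Qed.

End StructureEquations.

(** * Change of admissible coframe *)

Section Transition.
Variables (n : nat) (w t : 'I_n -> cdual R g) (a : 'I_n -> 'I_n -> R[i]).
Hypothesis JJ : forall Z, J (J Z) = - Z.
Hypothesis w_adm : admissible_coframe br J w.
Hypothesis t_adm : admissible_coframe br J t.
Hypothesis w_t : forall k X, w k X = \sum_(j < n) a k j * t j X.

Lemma common_kernel m X : (m <= n)%N ->
  (forall i : 'I_n, (i < m)%N -> w i X = 0) <->
  (forall i : 'I_n, (i < m)%N -> t i X = 0).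
Proof.
move=> mn.
have flag (u : 'I_n -> cdual R g) : admissible_coframe br J u ->
    asc br J (n - m) X <-> (forall i : 'I_n, (i < m)%N -> u i X = 0).
  move=> [u10 [A [B [uAB AB_top]]] _].
  rewrite (asc_kernel u10 uAB AB_top JJ).
  by split=> uX i; have := uX i; rewrite addnC -ltn_subRL subKn.
by rewrite -(flag w w_adm) -(flag t t_adm).
Qed.

(** The vector dual to t j is in the common kernel of the members of t up to k,
    hence of the members of w up to k. *)
Lemma transition_triangular (k j : 'I_n) : (k < j)%N -> a k j = 0.
Proof.
move=> kj; have [e te] := dual_vectors (admissible_basis t_adm).
have <- : w k (e j) = a k j.
  rewrite w_t (bigD1 j) //= te eqxx mulr1 big1 ?addr0 // => i ij.
  by rewrite te (negPf ij) mulr0.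
apply: ((common_kernel (e j) (ltn_ord k)).2 _ k) => // i ik.
by rewrite te -val_eqE /= ltn_eqF // (leq_ltn_trans _ kj).
Qed.

(** At the vector dual to w k the earlier members of both coframes vanish, so
    a k k t k is the only term of w k that can contribute the value 1. *)
Lemma transition_diag_neq0 (k : 'I_n) : a k k != 0.
Proof.
have [e we] := dual_vectors (admissible_basis w_adm).
have tek (i : 'I_n) : (i < k)%N -> t i (e k) = 0.
  apply: ((common_kernel (e k) (ltnW (ltn_ord k))).1 _ i) => j jk.
  by rewrite we -val_eqE /= ltn_eqF.
apply/eqP => akk; have := we k k; rewrite w_t eqxx big1 => [/eqP|j _].
  by rewrite eq_sym oner_eq0.
have [jk|kj|/val_inj ->] := ltngtP j k.
- by rewrite tek ?mulr0.
- by rewrite transition_triangular ?mul0r.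
- by rewrite akk mul0r.
Qed.

Lemma real_type_transition (k : 'I_n) : real_type br w k -> real_type br t k.
Proof.
move=> wk; have [//|tk] := admissible_types t_adm k.
have [/eqP] : a k k = 0 /\ (a k k)^* = 0; last first.
  by rewrite (negPf (transition_diag_neq0 k)).
(* Isolating j = k in the expansion of d (w k) + conj (d (w k)) = 0 in t. *)
apply/tk; exists (fun j => - a k j), (fun j => - (a k j)^*) => X Y.
pose f j := a k j * dform br (t j) X Y
  + (a k j)^* * dform br (conjform (t j)) X Y.
have f0 : \sum_j f j = 0.
  rewrite -[RHS](wk X Y) /dform /conjform w_t rmorph_sum -!sumrN -big_split /=.
  by apply: eq_bigr => j _; rewrite /f /dform /conjform rmorphM !mulrN.
transitivity (- \sum_(j < n | (j < k)%N) f j); last first.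
  by rewrite -sumrN; apply: eq_bigr => j _; rewrite opprD !mulNr.
apply/eqP; rewrite -addr_eq0 -/(f k) -[X in _ == X]f0.
rewrite [X in _ == X](bigD1 k) //=; apply/eqP.
congr (_ + _); rewrite [RHS](bigID (fun j : 'I_n => (j < k)%N)) /=.
rewrite [X in _ = _ + X]big1 ?addr0 => [|j /andP[jk]].
  by apply: eq_bigl => j; rewrite -val_eqE ltn_neqAle; case: eqP.
rewrite -leqNgt leq_eqVlt eq_sym val_eqE (negPf jk) /= => kj.
by rewrite /f transition_triangular // rmorph0 !mul0r addr0.
Qed.

End Transition.
End Coframes.

Theorem lemma1p12 (R : realType) (g : vectType R)
    (br : {bilinear g -> g -> g}) (J : 'End(g))
    (dim_gt0 : (0 < \dim {:g})%N)
    (gJ_MaxN : MaxN br J)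
    (w t : 'I_(cdim g) -> cdual R g)
    (w_adm : admissible_coframe br J w)
    (t_adm : admissible_coframe br J t)
    (a : 'I_(cdim g) -> 'I_(cdim g) -> R[i])
    (w_t : forall k X, w k X = \sum_(j < cdim g) a k j * t j X) :
  (forall k j : 'I_(cdim g), (k < j)%N -> a k j = 0) /\
  (forall k, a k k != 0) /\
  (forall k,
    (forall X Y, dform br (w k) X Y + dform br (conjform (w k)) X Y = 0) <->
    (forall X Y, dform br (t k) X Y + dform br (conjform (t k)) X Y = 0)).
Proof.
have JJ := complex_structure_sqr (MaxN_complex gJ_MaxN).
have /fin_all_exists[b t_w] k : exists c : 'I_(cdim g) -> R[i],
    forall X, t k X = \sum_(j < cdim g) c j * w j X.
  apply: (basis10_span (admissible_basis w_adm)).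
  exact: basis10_mem (admissible_basis t_adm) k.
split; first exact: transition_triangular JJ w_adm t_adm w_t.
split; first exact: transition_diag_neq0 JJ w_adm t_adm w_t.
move=> k; split.
  exact: (real_type_transition JJ w_adm t_adm w_t).
exact: (real_type_transition JJ t_adm w_adm t_w).
Qed.
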